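(* Let $\varepsilon>0$, let $n,m\ge 1$ and $\alpha\in(0,1)$. Consider a dataset of $n$ users in which user $i$ contributes $m$ samples $(s_{i,j},a^0_{i,j},a^1_{i,j},y_{i,j})$, $j\in[m]$, with known differential features $x_{i,j}=\phi(s_{i,j},a^1_{i,j})-\phi(s_{i,j},a^0_{i,j})\in\mathbb{R}^d$ and labels $y_{i,j}\in\{0,1\}$ drawn independently with $\mathbb{P}[y_{i,j}=1\mid x_{i,j}]=\sigma(x_{i,j}^\top\theta^* )$, where $\sigma(z)=1/(1+e^{-z})$. Suppose (Boundedness) $\theta^*\in\Theta_B=\{\theta\in\mathbb{R}^d:\langle \mathbf{1},\theta\rangle=0,\ \|\theta\|\le B\}$ and $\|\phi(s,a)\|\le L$ for all $(s,a)$. Apply user-level randomized response: independently for each $(i,j)$, $\tilde y_{i,j}=y_{i,j}$ with probability $\sigma(\varepsilon/m)=\frac{e^{\varepsilon/m}}{1+e^{\varepsilon/m}}$ and $\tilde y_{i,j}=1-y_{i,j}$ otherwise. Define $$\widehat l_{\mathcal D,\varepsilon}(\theta)=-\sum_{i=1}^n\sum_{j=1}^m\Big[\mathbb{1}(\tilde y_{i,j}=1)\log \widehat p^{\,1}_{i,j}+\mathbb{1}(\tilde y_{i,j}=0)\log\widehat p^{\,0}_{i,j}\Big],$$ $$\widehat p^{\,1}_{i,j}=\frac{\sigma(x_{i,j}^\top\theta)^{\sigma(\varepsilon/m)}}{(1-\sigma(x_{i,j}^\top\theta))^{1-\sigma(\varepsilon/m)}},\qquad \widehat p^{\,0}_{i,j}=\frac{(1-\sigma(x_{i,j}^\top\theta))^{\sigma(\varepsilon/m)}}{\sigma(x_{i,j}^\top\theta)^{1-\sigma(\varepsilon/m)}},$$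 and let $\widehat\theta_{\mathrm{RR}}\in\operatorname{argmin}_{\theta\in\Theta_B}\widehat l_{\mathcal D,\varepsilon}(\theta)$. Then $\widehat\theta_{\mathrm{RR}}$ is $\varepsilon$ user-level label differentially private, and with probability at least $1-\alpha$, $$\|\widehat\theta_{\mathrm{RR}}-\theta^*\|_2\le O\!\left(\frac{1}{\gamma\sqrt{\lambda_{\min}(\Sigma_{\mathcal D})}}\cdot\frac{e^{\varepsilon/m}+1}{e^{\varepsilon/m}-1}\sqrt{\frac{d+\log(1/\alpha)}{nm}}\right),$$ where $\gamma=\frac{1}{2+e^{-2LB}+e^{2LB}}$, $\Sigma_{\mathcal D}=\frac{1}{nm}\sum_{i=1}^n\sum_{j=1}^m x_{i,j}x_{i,j}^\top$, $\lambda_{\min}$ denotes the minimum eigenvalue, and $O(\cdot)$ hides a universal constant.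
   Context: A mechanism $\mathcal M$ on datasets of $n$ users each contributing $m$ samples is $(\varepsilon,\delta)$ user-level label differentially private if for any two datasets that differ only in the labels $y$ of the samples of a single user, and any event $O$, $\Pr[\mathcal M(\mathcal D)\in O]\le e^{\varepsilon}\Pr[\mathcal M(\mathcal D')\in O]+\delta$; the states and actions $(s,a^0,a^1)$ are considered public. $\varepsilon$ user-level label DP means $\delta=0$. $\phi:\mathcal S\times\mathcal A\to\mathbb{R}^d$ is a known fixed feature map (linear reward $r_\theta(s,a)=\phi(s,a)^\top\theta$, Bradley–Terry–Luce preference model). *)

(* Defs.v *)
From HB Require Import structures.
From mathcomp Require Import all_boot all_order all_algebra.
From mathcomp Require Import all_classical all_reals all_analysis.
Set Implicit Arguments. Unset Strict Implicit. Unset Printing Implicit Defensive.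
Import Order.TTheory GRing.Theory Num.Theory.
Local Open Scope ring_scope.

Section Defs.
Variable R : realType.

Definition sigmoid (z : R) : R := 1 / (1 + expR (- z)).

Definition dotv (d : nat) (u v : 'cV[R]_d) : R := \sum_(k < d) u k 0 * v k 0.
Definition norm2 (d : nat) (u : 'cV[R]_d) : R := Num.sqrt (dotv u u).

Definition ThetaB (d : nat) (B : R) (th : 'cV[R]_d) : Prop :=
  (\sum_(k < d) th k 0 = 0) /\ norm2 th <= B.

Definition idx (n m : nat) := ('I_n * 'I_m)%type.

Definition labels (n m : nat) := {ffun idx n m -> bool}.

Definition rr_rho (eps : R) (m : nat) : R := sigmoid (eps / m%:R).

Definition phat1 (rho z : R) : R :=
  (sigmoid z `^ rho) / ((1 - sigmoid z) `^ (1 - rho)).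
Definition phat0 (rho z : R) : R :=
  ((1 - sigmoid z) `^ rho) / (sigmoid z `^ (1 - rho)).

Definition rr_loss (d n m : nat) (eps : R) (x : idx n m -> 'cV[R]_d)
    (yt : labels n m) (th : 'cV[R]_d) : R :=
  - \sum_(k : idx n m)
      (if yt k then ln (phat1 (rr_rho eps m) (dotv (x k) th))
               else ln (phat0 (rr_rho eps m) (dotv (x k) th))).

Definition SigmaD (d n m : nat) (x : idx n m -> 'cV[R]_d) : 'M[R]_d :=
  (n * m)%:R^-1 *: \sum_(k : idx n m) (x k *m (x k)^T).

Definition is_lambda_min (d : nat) (M : 'M[R]_d) (lam : R) : Prop :=
  eigenvalue M lam /\ (forall b, eigenvalue M b -> lam <= b).

(* probability that a flip pattern occurs: f k = true means "flip" (prob 1-rho) *)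
Definition flip_weight (n m : nat) (rho : R) (f : labels n m) : R :=
  \prod_(k : idx n m) (if f k then 1 - rho else rho).

Definition rr_apply (n m : nat) (y f : labels n m) : labels n m :=
  [ffun k => xorb (y k) (f k)].

Definition label_weight (d n m : nat) (x : idx n m -> 'cV[R]_d)
    (thstar : 'cV[R]_d) (y : labels n m) : R :=
  \prod_(k : idx n m)
     (if y k then sigmoid (dotv (x k) thstar) else 1 - sigmoid (dotv (x k) thstar)).

Definition mech_prob (d n m : nat) (rho : R) (M : labels n m -> 'cV[R]_d)
    (y : labels n m) (O : set 'cV[R]_d) : R :=
  \sum_(f : labels n m | `[< O (M (rr_apply y f)) >]) flip_weight rho f.

Definition joint_prob (d n m : nat) (x : idx n m -> 'cV[R]_d) (thstar : 'cV[R]_d)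
    (rho : R) (E : labels n m -> labels n m -> Prop) : R :=
  \sum_(yf : labels n m * labels n m | `[< E yf.1 (rr_apply yf.1 yf.2) >])
     label_weight x thstar yf.1 * flip_weight rho yf.2.

Definition user_neighbors (n m : nat) (y y' : labels n m) : Prop :=
  exists i : 'I_n, forall k : idx n m, k.1 != i -> y k = y' k.

Definition user_label_DP (d n m : nat) (eps rho : R) (M : labels n m -> 'cV[R]_d) : Prop :=
  forall y y' : labels n m, user_neighbors y y' ->
  forall O : set 'cV[R]_d, mech_prob rho M y O <= expR eps * mech_prob rho M y' O.

Definition diff_feat (S A : Type) (d n m : nat) (phi : S -> A -> 'cV[R]_d)
    (s : idx n m -> S) (a0 a1 : idx n m -> A) : idx n m -> 'cV[R]_d :=
  fun k => phi (s k) (a1 k) - phi (s k) (a0 k).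

Definition gammaLB (L B : R) : R :=
  1 / (2 + expR (- (2 * L * B)) + expR (2 * L * B)).

End Defs.

(* Main.v *)
Require Import Defs.
From HB Require Import structures.
From mathcomp Require Import all_boot all_order all_algebra.
From mathcomp Require Import all_classical all_reals all_analysis.
From mathcomp Require Import ring lra.

(** Flipping labels independently with odds [exp (eps / m)] changes the weight of a
flip pattern by at most that factor per label, hence by [exp eps] per user.

For the error bound, put [z = <x_k, theta>], [c = 2 rho - 1] and
[A z = ln (1 + e^z)]; the summands of the loss are [c A z - (yt_k - (1 - rho)) z].
As [A'' >= gamma] on the range of [z], minimality of the estimator gives
[c gamma / 2 * Q <= <S, D>], where [D] is the estimation error,
[Q = sum_k <x_k, D>^2], and [S = sum_k xi_k x_k] with [xi_k] the centered
randomized labels. Whitening by a [T] with [T (sum_k x_k x_k^T) T^T = 1] and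
Cauchy-Schwarz turn this into [(c gamma / 2)^2 Q <= |T S|^2]. The vector [T S] is
sub-Gaussian with a dimension-free constant, and mixing its exponential moments
over the integer lattice with Gaussian weights gives
[E exp (|T S|^2 / 12) <= exp (5 d)], so that [|T S|^2 <= 60 (d + ln (1 / alpha))]
with probability at least [1 - alpha]. Finally [Q >= n m lambda_min |D|^2]. *)

Set Implicit Arguments.
Unset Strict Implicit.
Unset Printing Implicit Defensive.
Import Order.TTheory GRing.Theory Num.Theory.
Import numFieldNormedType.Exports.
Local Open Scope ring_scope.

(** * Quadratic forms, the smallest eigenvalue and whitening *)

Lemma sqr_le_mul_of_quadratic_ge0 {R : realType} (a b c : R) :
  0 <= a -> (forall t, 0 <= c - 2 * t * b + t ^+ 2 * a) -> b ^+ 2 <= a * c.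
Proof.
move=> a0 h; have [a00|an0] := eqVneq a 0; last first.
  (* The minimizer of the quadratic in [t]. *)
  have := h (b / a); have ap : 0 < a by rewrite lt_neqAle eq_sym an0.
  have -> : c - 2 * (b / a) * b + (b / a) ^+ 2 * a = c - b ^+ 2 / a by field.
  by rewrite subr_ge0 ler_pdivrMr// mulrC.
rewrite a00 mul0r; have [->|bn0] := eqVneq b 0; first by rewrite expr0n.
(* With [a = 0] the expression is affine in [t], and this [t] gives it the value -1. *)
have := h ((c + 1) / (2 * b)); rewrite a00 mulr0 addr0.
have -> : c - 2 * ((c + 1) / (2 * b)) * b = - 1 by field.
by rewrite ler0N1.
Qed.

Section DotProduct.
Context {R : realType}.
Implicit Types (d : nat).

Lemma dotvC d (u v : 'cV[R]_d) : dotv u v = dotv v u.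
Proof. by apply: eq_bigr => k _; rewrite mulrC. Qed.

Lemma dotvDr d (u v w : 'cV[R]_d) : dotv u (v + w) = dotv u v + dotv u w.
Proof. by rewrite /dotv -big_split; apply: eq_bigr => k _; rewrite mxE mulrDr. Qed.

Lemma dotvDl d (u v w : 'cV[R]_d) : dotv (v + w) u = dotv v u + dotv w u.
Proof. by rewrite dotvC dotvDr !(dotvC u). Qed.

Lemma dotvZr d a (u v : 'cV[R]_d) : dotv u (a *: v) = a * dotv u v.
Proof. by rewrite /dotv mulr_sumr; apply: eq_bigr => k _; rewrite mxE mulrCA. Qed.

Lemma dotvZl d a (u v : 'cV[R]_d) : dotv (a *: u) v = a * dotv u v.
Proof. by rewrite dotvC dotvZr dotvC. Qed.

Lemma dotvBr d (u v w : 'cV[R]_d) : dotv u (v - w) = dotv u v - dotv u w.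
Proof. by rewrite -scaleN1r dotvDr dotvZr mulN1r. Qed.

Lemma dotvBl d (u v w : 'cV[R]_d) : dotv (v - w) u = dotv v u - dotv w u.
Proof. by rewrite dotvC dotvBr !(dotvC u). Qed.

Lemma dotv0r d (u : 'cV[R]_d) : dotv u 0 = 0.
Proof. by rewrite -(scale0r 0) dotvZr mul0r. Qed.

Lemma dotv_suml d (I : finType) (F : I -> 'cV[R]_d) u :
  dotv (\sum_i F i) u = \sum_i dotv (F i) u.
Proof.
elim/big_rec2: _ => [|i x y _ <-]; last by rewrite dotvDl.
by rewrite dotvC dotv0r.
Qed.

Lemma dotv_ge0 d (u : 'cV[R]_d) : 0 <= dotv u u.
Proof. by apply: sumr_ge0 => k _; rewrite -expr2 sqr_ge0. Qed.

Lemma dotv_eq0 d (u : 'cV[R]_d) : dotv u u = 0 -> u = 0.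
Proof.
move=> /eqP; rewrite psumr_eq0; last by move=> k _; rewrite -expr2 sqr_ge0.
move=> /allP h; apply/matrixP => k j; rewrite ord1 mxE.
by have := h k (mem_index_enum k); rewrite mulf_eq0 orbb => /eqP.
Qed.

Lemma dotv_gt0 d (u : 'cV[R]_d) : u != 0 -> 0 < dotv u u.
Proof.
move=> un0; rewrite lt_neqAle dotv_ge0 andbT eq_sym.
by apply: contra_neq un0 => /dotv_eq0.
Qed.

Lemma dotvE d (u v : 'cV[R]_d) : dotv u v = (u^T *m v) 0 0.
Proof. by rewrite mxE; apply: eq_bigr => k _; rewrite mxE. Qed.

Lemma dotv_mulmx d e (M : 'M[R]_(d, e)) u v : dotv u (M *m v) = dotv (M^T *m u) v.
Proof. by rewrite !dotvE trmx_mul trmxK mulmxA. Qed.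

Definition psd d (M : 'M[R]_d) := forall v : 'cV[R]_d, 0 <= dotv v (M *m v).

Lemma psd_cauchy_schwarz d (M : 'M[R]_d) (u v : 'cV[R]_d) :
  M^T = M -> psd M ->
  dotv u (M *m v) ^+ 2 <= dotv u (M *m u) * dotv v (M *m v).
Proof.
move=> Msym Mpsd; apply: sqr_le_mul_of_quadratic_ge0 => [//|t].
have := Mpsd (v - t *: u).
rewrite mulmxBr -scalemxAr !dotvBl !dotvBr !dotvZl !dotvZr.
rewrite [dotv v (M *m u)]dotv_mulmx Msym (dotvC _ u).
by congr (_ <= _); ring.
Qed.

Lemma dotv_cauchy_schwarz d (u v : 'cV[R]_d) :
  dotv u v ^+ 2 <= dotv u u * dotv v v.
Proof.
have := @psd_cauchy_schwarz d 1%:M u v (trmx1 _ _).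
by rewrite !mul1mx; apply => w; rewrite mul1mx dotv_ge0.
Qed.

Lemma quadratic_form_bounded d (M : 'M[R]_d) :
  exists2 K, 0 < K & forall v : 'cV[R]_d, `|dotv v (M *m v)| <= K * dotv v v.
Proof.
(* The summand 1 keeps the constant positive even for [M = 0], so that it can be inverted later. *)
exists (1 + \sum_i \sum_j `|M i j|) => [|v].
  by rewrite ltr_pwDl// sumr_ge0// => i _; rewrite sumr_ge0.
rewrite mulrDl mul1r ler_wpDl ?dotv_ge0//.
have sq_le i : v i 0 ^+ 2 <= dotv v v.
  rewrite /dotv (bigD1 i)//= expr2 lerDl sumr_ge0// => k _.
  by rewrite -expr2 sqr_ge0.
rewrite mulr_suml /dotv (le_trans (ler_norm_sum _ _ _))// ler_sum// => i _.
rewrite normrM mulr_suml mxE mulrC.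
apply: le_trans (ler_wpM2r (normr_ge0 _) (ler_norm_sum _ _ _)) _.
rewrite mulr_suml ler_sum// => j _; rewrite normrM -mulrA ler_wpM2l//.
have := sq_le i; have := sq_le j; rewrite -(real_normK (num_real (v i 0))).
rewrite -(real_normK (num_real (v j 0))).
rewrite -/(dotv v v); have := sqr_ge0 (`|v i 0| - `|v j 0|); nra.
Qed.

(* Cauchy-Schwarz for the form [M] at [(M^-1 v, v)] gives
   [|v|^4 <= <v, M^-1 v> <v, M v>]. *)
Lemma psd_unit_coercive d (M : 'M[R]_d) :
  M^T = M -> psd M -> M \in unitmx ->
  exists2 e, 0 < e & forall v : 'cV[R]_d, e * dotv v v <= dotv v (M *m v).
Proof.
move=> Msym Mpsd Mu; have [K K0 hK] := quadratic_form_bounded (invmx M).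
exists K^-1; rewrite ?invr_gt0// => v.
rewrite mulrC ler_pdivrMr//.
have [v0|v0] := ltP 0 (dotv v v); last by rewrite (le_trans v0)// mulr_ge0// ltW.
rewrite -(ler_pM2l v0).
have := psd_cauchy_schwarz (invmx M *m v) v Msym Mpsd.
rewrite mulKVmx// dotv_mulmx Msym mulKVmx// -expr2 => /le_trans; apply.
have hb : dotv (invmx M *m v) v <= K * dotv v v.
  by rewrite dotvC (le_trans (ler_norm _)).
by apply: le_trans (ler_wpM2r (Mpsd v) hb) _; lra.
Qed.

(* The supremum [t] of the [s] such that [M - s] is positive semidefinite is an
   eigenvalue: otherwise [M - t] would be coercive and [t] could be increased. *)
Lemma rayleigh_lambda_min d (M : 'M[R]_d) lam :
  M^T = M -> is_lambda_min M lam ->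
  forall v : 'cV[R]_d, lam * dotv v v <= dotv v (M *m v).
Proof.
move=> Msym [/eigenvalueP[w wM wn0] lam_min].
pose E := [set t : R | forall v : 'cV[R]_d, t * dotv v v <= dotv v (M *m v)]%classic.
have [K K0 hK] := quadratic_form_bounded M.
have En0 : (E !=set0)%classic.
  by exists (- K) => v; have := hK v; rewrite ler_norml mulNr => /andP[].
have wT0 : 0 < dotv w^T w^T.
  by rewrite dotv_gt0// -(trmx0 _ 1 d) (can_eq (@trmxK _ _ _)).
have Eub : has_ubound E.
  exists K => t /(_ w^T) ht; rewrite -(ler_pM2r wT0) (le_trans ht)//.
  by rewrite (le_trans (ler_norm _)).
have supE : E (sup E).
  move=> v; have [v0|v0] := ltP 0 (dotv v v); last first.
    have -> : v = 0 by apply/dotv_eq0/le_anti; rewrite v0 dotv_ge0.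
    by rewrite mulmx0 dotv0r mulr0.
  rewrite -ler_pdivlMr//; apply: ge_sup => // t /(_ v).
  by rewrite -ler_pdivlMr.
have Nsym : (M - (sup E)%:M)^T = M - (sup E)%:M.
  by rewrite linearB /= Msym tr_scalar_mx.
have formN v : dotv v ((M - (sup E)%:M) *m v) = dotv v (M *m v) - sup E * dotv v v.
  by rewrite mulmxBl dotvBr mul_scalar_mx dotvZr.
have Npsd : psd (M - (sup E)%:M) by move=> v; rewrite formN subr_ge0 supE.
have supeig : eigenvalue M (sup E).
  have [Nu|Nu] := boolP (M - (sup E)%:M \in unitmx).
    have [e e0 he] := psd_unit_coercive Nsym Npsd Nu.
    have : E (sup E + e).
      by move=> v; have := he v; rewrite formN; lra.
    by move=> /(ub_le_sup Eub); rewrite gerDl leNgt e0.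
  rewrite /eigenvalue /eigenspace kermx_eq0.
  by rewrite row_free_unit.
move=> v; apply: le_trans (supE v).
by rewrite ler_wpM2r ?dotv_ge0// lam_min.
Qed.

(* Gram-Schmidt: as long as [k < d], the kernel of [v |-> T G v] is nonzero, which
   provides a further row. *)
Lemma psd_partial_whitening d (G : 'M[R]_d) k :
  G^T = G -> (forall v : 'cV[R]_d, v != 0 -> 0 < dotv v (G *m v)) ->
  (k <= d)%N -> exists T : 'M[R]_(k, d), T *m G *m T^T = 1%:M.
Proof.
move=> Gsym Gpd; elim: k => [_|k IH kd].
  by exists 0; apply/matrixP => -[].
have [T TG] := IH (ltnW kd).
have : kermx (G *m T^T) != 0.
  rewrite -mxrank_eq0 mxrank_ker subn_eq0 -ltnNge.
  exact: leq_ltn_trans (rank_leq_col _) kd.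
move=> /rowV0Pn[u /sub_kermxP uGT un0].
have q0 : 0 < (u *m G *m u^T) 0 0.
  have := Gpd u^T; rewrite dotvE trmxK mulmxA; apply.
  by rewrite -(trmx0 _ 1 d) (can_eq (@trmxK _ _ _)).
(* The new row [u] is already [G]-orthogonal to the rows of [T]; the factor [s] gives it unit
   [G]-length. *)
pose s := (Num.sqrt ((u *m G *m u^T) 0 0))^-1.
have ss : s * (s * (u *m G *m u^T) 0 0) = 1.
  rewrite /s -{3}(sqr_sqrtr (ltW q0)) expr2.
  by rewrite mulKf ?mulVf// gt_eqF// sqrtr_gt0.
suff : exists T : 'M[R]_(k + 1, d), T *m G *m T^T = 1%:M by rewrite addn1.
exists (col_mx T (s *: u)).
rewrite mul_col_mx tr_col_mx mul_col_row TG scalar_mx_block.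
have uGT' : u *m G *m T^T = 0 by rewrite -mulmxA.
congr block_mx.
- rewrite linearZ /= -scalemxAr (_ : T *m G *m u^T = 0) ?scaler0//.
  by apply: trmx_inj; rewrite !trmx_mul trmxK Gsym mulmxA uGT' trmx0.
- by rewrite -!scalemxAl uGT' scaler0.
apply/matrixP => i j; rewrite !ord1 linearZ /= -scalemxAr -!scalemxAl.
by rewrite mxE [X in _ * X]mxE ss mxE.
Qed.

End DotProduct.

(** * Calculus of the sigmoid and of its primitive, and a Bernoulli moment bound *)

Section Sigmoid.
Context {R : realType}.
Implicit Types z a b x t K : R.

Definition softplus z : R := ln (1 + expR z).

Lemma expR1D_gt0 z : 0 < 1 + expR z.
Proof. by rewrite addr_gt0// expR_gt0. Qed.

Lemma sigmoidE z : sigmoid z = expR z / (1 + expR z).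
Proof.
have := expR1D_gt0 z; have := expR_gt0 z; rewrite /sigmoid expRN => e0 e1.
by field; rewrite !gt_eqF//= addrC.
Qed.

Lemma onem_sigmoid z : 1 - sigmoid z = (1 + expR z)^-1.
Proof. by rewrite sigmoidE; field; rewrite gt_eqF// expR1D_gt0. Qed.

Lemma sigmoid_gt0 z : 0 < sigmoid z.
Proof. by rewrite sigmoidE divr_gt0 ?expR_gt0 ?expR1D_gt0. Qed.

Lemma onem_sigmoid_gt0 z : 0 < 1 - sigmoid z.
Proof. by rewrite onem_sigmoid invr_gt0 expR1D_gt0. Qed.

Lemma ln_onem_sigmoid z : ln (1 - sigmoid z) = - softplus z.
Proof. by rewrite onem_sigmoid lnV// posrE expR1D_gt0. Qed.

Lemma ln_sigmoid z : ln (sigmoid z) = z - softplus z.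
Proof.
by rewrite sigmoidE ln_div ?posrE ?expR_gt0 ?expR1D_gt0// expRK.
Qed.

(** The exponents in the loss are chosen so that [softplus] gets the same weight [2 * rho - 1] for
    both labels; only the linear term depends on the label seen. *)
Lemma ln_phat1 (rho z : R) :
  ln (phat1 rho z) = rho * z - (2 * rho - 1) * softplus z.
Proof.
rewrite /phat1 ln_div ?posrE ?powR_gt0 ?sigmoid_gt0 ?onem_sigmoid_gt0//.
by rewrite !ln_powR ln_sigmoid ln_onem_sigmoid; ring.
Qed.

Lemma ln_phat0 (rho z : R) :
  ln (phat0 rho z) = - (1 - rho) * z - (2 * rho - 1) * softplus z.
Proof.
rewrite /phat0 ln_div ?posrE ?powR_gt0 ?sigmoid_gt0 ?onem_sigmoid_gt0//.
by rewrite !ln_powR ln_sigmoid ln_onem_sigmoid; ring.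
Qed.

Lemma is_derive_expR1D z : is_derive z 1 (fun x => 1 + expR x) (expR z).
Proof.
have := is_deriveD (is_derive_cst (1 : R) z 1) (is_derive_expR z).
by rewrite add0r.
Qed.

Lemma is_derive_softplus z : is_derive z 1 softplus (sigmoid z).
Proof.
have := @is_derive1_comp R (@ln R) (fun x => 1 + expR x) z _ _
  (is_derive1_ln (expR1D_gt0 z)) (is_derive_expR1D z).
by rewrite sigmoidE mulrC.
Qed.

Lemma is_derive_sigmoid z : is_derive z 1 (@sigmoid R) (sigmoid z * (1 - sigmoid z)).
Proof.
have n0 : 1 + expR z != 0 by rewrite gt_eqF// expR1D_gt0.
have := is_deriveB (is_derive_cst (1 : R) z 1) 
  (@is_deriveV R (fun x => 1 + expR x) z _ _ n0 (is_derive_expR1D z)).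
rewrite (_ : _ - (fun y => (1 + expR y)^-1) = @sigmoid R); last first.
  apply/funext => x; rewrite [LHS](_ : _ = 1 - (1 + expR x)^-1)//.
  by rewrite -onem_sigmoid opprB addrC subrK.
congr (is_derive _ _ _ _).
rewrite onem_sigmoid sigmoidE /GRing.scale /=.
by field.
Qed.

(** The derivative of the sigmoid equals [1 / (2 + e^-a + e^a)], which is even and decreases with
    [|a|]. *)
Lemma sigmoid_deriv_ge a K : `|a| <= K ->
  1 / (2 + expR (- K) + expR K) <= sigmoid a * (1 - sigmoid a).
Proof.
move=> aK.
have K0 := expR_gt0 K; have ea := expR_gt0 a.
have -> : sigmoid a * (1 - sigmoid a) = 1 / (2 + expR (- a) + expR a).
  by rewrite sigmoidE expRN; field; rewrite !gt_eqF//; nra.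
have pos x : 0 < 2 + expR (- x) + expR x.
  by rewrite !addr_gt0// ?expR_gt0.
rewrite !div1r lef_pV2 ?posrE//.
rewrite -!(addrA 2) lerD2l.
have -> : expR (- a) + expR a = expR (- `|a|) + expR `|a|.
  by case: (ger0P a) => // _; rewrite opprK addrC.
rewrite !expRN.
have t1 : 1 <= expR `|a| by rewrite -expR0 ler_expR.
have tK : expR `|a| <= expR K by rewrite ler_expR.
set u := expR `|a| in t1 tK *; set v := expR K in tK *.
(* Monotonicity of [u + u^-1] on [u >= 1], through an explicit difference. *)
have -> : v^-1 + v = u^-1 + u + (v - u) * (1 - (u * v)^-1).
  by field; rewrite !gt_eqF//; lra.
rewrite lerDl mulr_ge0 ?subr_ge0// invf_le1; nra.
Qed.

(** Covers both orders of the endpoints, since true and estimated scores come in no fixed order. *)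
Lemma mvt_between (f df : R -> R) a b : (forall x, is_derive x 1 f (df x)) ->
  exists2 c, (a <= c <= b) || (b <= c <= a) & f b - f a = df c * (b - a).
Proof.
move=> fdf.
have fcont u v : ({within `[u, v], continuous f})%classic.
  apply: continuous_subspaceT => x; apply: differentiable_continuous.
  by apply/derivable1_diffP; case: (fdf x).
have [ab|ba] := leP a b.
  have [c] := MVT_segment ab (fun x _ => fdf x) (fcont a b).
  by rewrite in_itv /= => cab ->; exists c => //; rewrite cab.
have [c] := MVT_segment (ltW ba) (fun x _ => fdf x) (fcont b a).
rewrite in_itv /= => cab E; exists c => //; first by rewrite cab orbT.
by rewrite -opprB E -mulrN opprB.
Qed.

(** Two uses of the mean value theorem: on [softplus] minus its quadratic minorant, giving [c], then
    on the sigmoid between [a] and [c]. As [c] lies between [a] and [b], the product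
    [(c - a) (b - a)] is nonnegative. *)
Lemma softplus_strongly_convex a b K : `|a| <= K -> `|b| <= K ->
  sigmoid a * (b - a) + (1 / (2 + expR (- K) + expR K)) / 2 * (b - a) ^+ 2
   <= softplus b - softplus a.
Proof.
move=> aK bK; set g := 1 / _.
pose h x := sigmoid a * (x - a) + g / 2 * (x - a) ^+ 2.
have hd x : is_derive x 1 (fun x => softplus x - h x)
                      (sigmoid x - (sigmoid a + g * (x - a))).
  have dxa : is_derive x 1 (fun x => x - a) 1.
    by have := is_deriveB (is_derive_id x 1) (is_derive_cst a x 1); rewrite subr0.
  have d1 := is_deriveZ (sigmoid a) dxa.
  have d2 := is_deriveZ (g / 2) (is_deriveM dxa dxa).
  have := is_deriveB (is_derive_softplus x) (is_deriveD d1 d2).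
  by congr (is_derive _ _ _ _); rewrite /GRing.scale /=; field.
have [c cab] := mvt_between a b hd.
have [e eac] := mvt_between a c is_derive_sigmoid.
have /sigmoid_deriv_ge : `|e| <= K.
  by move: aK bK cab eac; rewrite !ler_norml => /andP[? ?] /andP[? ?];
     move=> /orP[] /andP[? ?] /orP[] /andP[? ?]; apply/andP; split; lra.
rewrite -/g => ge Ee Ec.
suff : 0 <= (sigmoid c - (sigmoid a + g * (c - a))) * (b - a).
  by rewrite -Ec /h subrr expr0n /=; lra.
have -> : sigmoid c - (sigmoid a + g * (c - a)) =
    (sigmoid e * (1 - sigmoid e) - g) * (c - a) by lra.
rewrite -mulrA mulr_ge0 ?subr_ge0//.
by case/orP: cab => /andP[? ?]; [rewrite mulr_ge0// | rewrite mulr_le0//]; lra.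
Qed.

(** Isolates the linear term of the exponential, which vanishes in expectation for a centered
    variable. For [x < 1] it follows from [e^-x >= (1 - x / 2)^2]. *)
Lemma expR_le_addr_expR_sqr x : expR x <= x + expR (2 * x ^+ 2).
Proof.
have [x1|x1] := leP 1 x.
  rewrite ler_wpDl ?(le_trans _ x1)// ler_expR; nra.
have h1 : 0 < 1 - x / 2 by lra.
have e2 : expR x <= 1 + x + 2 * x ^+ 2.
  have h2 : 1 - x / 2 <= expR (- (x / 2)) by exact: expR_ge1Dx.
  have h3 : (1 - x / 2) ^+ 2 <= expR (- x).
    have -> : - x = - (x / 2) + - (x / 2) by field.
    by rewrite expRD expr2 ler_pM// ltW.
  have h4 : 1 <= (1 + x + 2 * x ^+ 2) * (1 - x / 2) ^+ 2.
    (* Four times the excess of the right-hand side over 1. *)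
    have : 0 <= x ^+ 2 * ((5 - 2 * x) * (1 - x)).
      by rewrite mulr_ge0 ?sqr_ge0// mulr_ge0//; lra.
    by lra.
  have h5 : 0 <= 1 + x + 2 * x ^+ 2 by nra.
  have := le_trans h4 (ler_wpM2l h5 h3).
  by rewrite expRN ler_pdivlMr ?expR_gt0// mul1r.
have := expR_ge1Dx (2 * x ^+ 2); lra.
Qed.

(** The two linear terms cancel by centering, and both centered values lie in [[-1, 1]]. *)
Lemma bernoulli_mgf_le q t : 0 <= q -> q <= 1 ->
  q * expR (t * (1 - q)) + (1 - q) * expR (t * (0 - q)) <= expR (2 * t ^+ 2).
Proof.
move=> q0 q1.
have sq y : -1 <= y <= 1 -> expR (2 * (t * y) ^+ 2) <= expR (2 * t ^+ 2).
  move=> /andP[y0 y1]; rewrite ler_expR ler_pM2l// exprMn.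
  by rewrite ler_piMr ?sqr_ge0//; nra.
have e1 : expR (t * (1 - q)) <= t * (1 - q) + expR (2 * t ^+ 2).
  by apply: le_trans (expR_le_addr_expR_sqr _) _; rewrite lerD2l sq//; apply/andP; split; lra.
have e0 : expR (t * (0 - q)) <= t * (0 - q) + expR (2 * t ^+ 2).
  by apply: le_trans (expR_le_addr_expR_sqr _) _; rewrite lerD2l sq//; apply/andP; split; lra.
have q1' : 0 <= 1 - q by lra.
have := lerD (ler_wpM2l q0 e1) (ler_wpM2l q1' e0).
by move=> /le_trans; apply; lra.
Qed.

End Sigmoid.

(** * Gaussian sums over the integers *)

Section Lattice.
Context {R : realType}.

(** The integers from [- N] to [N], indexed so that sums over them are finite. *)
Definition centered (N : nat) (i : 'I_(2 * N + 1)) : R := i%:R - N%:R.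

Lemma centered_dense (N : nat) (w : R) : `|w| <= N%:R ->
  exists i : 'I_(2 * N + 1), `|centered i - w| <= 1.
Proof.
rewrite ler_norml => /andP[wl wu].
have wN : 0 <= w + N%:R by lra.
have /andP[t1 t2] := truncn_itv wN.
have ltN : (Num.truncn (w + N%:R) < 2 * N + 1)%N.
  rewrite addn1 ltnS -(ler_nat R) (le_trans t1)// natrM; lra.
exists (Ordinal ltN); rewrite /centered /= ler_norml.
by move: t2; rewrite -natr1 => t2; apply/andP; split; lra.
Qed.

(* Complete the square, and keep the lattice point nearest to [v / 6]. *)
Lemma lattice_mix_ge (N : nat) (v : R) : `|v| <= N%:R ->
  expR (v ^+ 2 / 12 - 3) <=
  \sum_(i < 2 * N + 1) expR (- 3 * centered i ^+ 2 + centered i * v).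
Proof.
move=> vN; have [|i hi] := @centered_dense N (v / 6).
  rewrite normrM (@ger0_norm _ 6^-1)// (le_trans _ vN)//.
  by rewrite ler_piMr// invf_le1// ler1n.
rewrite (bigD1 i)//= (@le_trans _ _ (expR (- 3 * centered i ^+ 2 + centered i * v)))//.
  rewrite ler_expR.
  have h : (centered i - v / 6) ^+ 2 <= 1.
    by rewrite -(real_normK (num_real _)) expr_le1.
  nra.
by rewrite lerDl sumr_ge0// => j _; exact: expR_ge0.
Qed.

Lemma expRN1_le_half : expR (- 1 : R) <= 2^-1.
Proof.
by rewrite expRN lef_pV2 ?posrE ?expR_gt0// (le_trans _ (expR_ge1Dx _))//; lra.
Qed.

Lemma lattice_gauss_le (N : nat) :
  \sum_(i < 2 * N + 1) expR (- (centered i) ^+ 2) <= 3 :> R.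
Proof.
(* Strengthened for induction: the new points at distance [N + 1] from 0 add at most
   [2 * 2^-(N + 1)], exactly the growth of this bound. *)
suff : \sum_(i < 2 * N + 1) expR (- (centered i) ^+ 2) <= 3 - 2 * 2^-1 ^+ N :> R.
  by move=> /le_trans; apply; rewrite gerBl mulr_ge0// exprn_ge0// invr_ge0.
have E M : \sum_(i < 2 * M + 1) expR (- (centered i) ^+ 2) =
           \sum_(0 <= i < 2 * M + 1) expR (- (i%:R - M%:R) ^+ 2) :> R.
  by rewrite big_mkord.
elim: N => [|N IH].
  by rewrite E muln0 add0n big_nat1 subr0 expr0n /= oppr0 expR0; lra.
rewrite E mulnS addnAC addn1 !addSn add0n big_nat_recl// big_nat_recr//=.
(* With both extreme points split off, an index shift recenters the rest. *)
have -> : \sum_(0 <= i < (2 * N).+1) expR (- (i.+1%:R - N.+1%:R) ^+ 2) =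
  \sum_(i < 2 * N + 1) expR (- (centered i) ^+ 2) :> R.
  rewrite E addn1; apply: eq_bigr => i _; congr (expR (- _ ^+ 2)).
  by rewrite -(natr1 i) -(natr1 N); lra.
have hN : expR (- N.+1%:R ^+ 2) <= 2^-1 ^+ N.+1 :> R.
  have -> : - N.+1%:R ^+ 2 = - (1 : R) * (N.+1 * N.+1)%:R.
    by rewrite natrM expr2 mulN1r.
  rewrite expRM_natr.
  apply: (@le_trans _ _ (2^-1 ^+ (N.+1 * N.+1))).
    by rewrite lerXn2r ?nnegrE ?expR_ge0 ?invr_ge0 ?expRN1_le_half.
  by rewrite ler_wiXn2l ?invr_ge0 ?invf_le1 ?ler1n// leq_pmulr.
rewrite sub0r sqrrN.
have -> : (2 * N).+2%:R - N.+1%:R = N.+1%:R :> R.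
  by rewrite -!natr1 natrM; lra.
have h2 : (2^-1 : R) ^+ N.+1 = 2^-1 ^+ N / 2 by rewrite exprSr.
lra.
Qed.

End Lattice.

(** * Tail bound for sub-Gaussian vectors *)

Section FiniteProbability.
Context {R : realType}.

Lemma sum_prod_bool (K : finType) (F : K -> bool -> R) :
  \sum_(y : {ffun K -> bool}) \prod_k F k (y k) = \prod_k (F k true + F k false).
Proof.
by rewrite -bigA_distr_bigA; apply: eq_bigr => k _; rewrite big_bool.
Qed.

Lemma sum_expR_lattice d (N : nat) (F : R -> R -> R) (V : 'cV[R]_d) :
  \prod_(j < d) \sum_(a < 2 * N + 1) expR (F (centered a) (V j 0)) =
  \sum_(u : {ffun 'I_d -> 'I_(2 * N + 1)}) expR (\sum_j F (centered (u j)) (V j 0)).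
Proof.
by rewrite bigA_distr_bigA; apply: eq_bigr => u _; rewrite expR_sum.
Qed.

(* [exp (|V|^2 / 12)] is dominated by a Gaussian mixture over the integer lattice
   of the exponentials [exp <u, V>]. *)
Lemma subgaussian_expR_norm_sq_le (I : finType) (P : I -> R) d (V : I -> 'cV[R]_d) :
  (forall i, 0 <= P i) ->
  (forall u, \sum_i P i * expR (dotv u (V i)) <= expR (2 * dotv u u)) ->
  \sum_i P i * expR (dotv (V i) (V i) / 12) <= expR (5 * d%:R).
Proof.
move=> P0 mgf.
(* A window containing every coordinate of every [V i]; it exists because [I] is finite, and [N]
   does not enter the final bound. *)
have [N hN] : exists N : nat, forall i j, `|V i j 0| <= N%:R.
  exists (Num.truncn (\sum_i \sum_j `|V i j 0|)).+1 => i j.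
  rewrite (le_trans _ (ltW (truncnS_gt _)))//.
  rewrite (bigD1 i)//= (bigD1 j)//= -addrA lerDl addr_ge0 ?sumr_ge0// => k _.
  by rewrite sumr_ge0.
pose uv (u : {ffun 'I_d -> 'I_(2 * N + 1)}) : 'cV[R]_d := \col_j centered (u j).
have step i : expR (dotv (V i) (V i) / 12 - 3 * d%:R) <=
    \sum_(u : {ffun 'I_d -> 'I_(2 * N + 1)})
       expR (- 3 * dotv (uv u) (uv u)) * expR (dotv (uv u) (V i)).
  have -> : dotv (V i) (V i) / 12 - 3 * d%:R = \sum_j ((V i j 0) ^+ 2 / 12 - 3).
    rewrite sumrB sumr_const card_ord mulr_natr mulr_suml.
    by congr (_ - _); apply: eq_bigr => j _; rewrite expr2.
  rewrite expR_sum.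
  apply: (@le_trans _ _ (\prod_(j < d) \sum_(a < 2 * N + 1)
      expR (- 3 * centered a ^+ 2 + centered a * V i j 0))).
    apply: ler_prod => j _; rewrite expR_ge0 /=.
    exact: lattice_mix_ge.
  rewrite (sum_expR_lattice N (fun a v => - 3 * a ^+ 2 + a * v)).
  apply: ler_sum => u _; rewrite -expRD ler_expR le_eqVlt; apply/orP; left; apply/eqP.
  rewrite big_split -mulr_sumr; congr (_ * _ + _); apply: eq_bigr => j _; rewrite !mxE//.
(* The moment hypothesis turns the weight [-3 |u|^2] into [-|u|^2], and each coordinate then sums to
   at most [3 <= e^2]. The [3 d] lost in completing squares brings the exponent to [5 d]. *)
have : \sum_i P i * expR (dotv (V i) (V i) / 12 - 3 * d%:R) <= expR (2 * d%:R).
  apply: (@le_trans _ _ (\sum_(u : {ffun 'I_d -> 'I_(2 * N + 1)})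
      expR (- dotv (uv u) (uv u)))).
    apply: (@le_trans _ _ (\sum_i \sum_u P i *
        (expR (- 3 * dotv (uv u) (uv u)) * expR (dotv (uv u) (V i))))).
      by apply: ler_sum => i _; rewrite -mulr_sumr ler_wpM2l.
    rewrite exchange_big /=; apply: ler_sum => u _.
    under eq_bigr do rewrite mulrCA.
    rewrite -mulr_sumr (le_trans (ler_wpM2l (expR_ge0 _) (mgf _)))//.
    by rewrite -expRD ler_expR; lra.
  have -> : \sum_(u : {ffun 'I_d -> 'I_(2 * N + 1)}) expR (- dotv (uv u) (uv u)) =
      \prod_(j < d) \sum_(a < 2 * N + 1) expR (- (centered a) ^+ 2).
    rewrite (sum_expR_lattice N (fun a _ => - a ^+ 2) (0 : 'cV_d)).
    apply: eq_bigr => u _; rewrite -sumrN; congr expR; apply: eq_bigr => j _.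
    by rewrite !mxE.
  apply: (@le_trans _ _ (\prod_(j < d) expR 2)).
    apply: ler_prod => j _; rewrite sumr_ge0 ?(le_trans (lattice_gauss_le _))//=.
    by rewrite (le_trans _ (expR_ge1Dx _))//; lra.
  by rewrite prodr_const card_ord mulr_natr -expRM_natr mulr_natr.
under eq_bigr do rewrite expRD mulrA.
rewrite -mulr_suml expRN ler_pdivrMr ?expR_gt0// -expRD => /le_trans; apply.
by rewrite ler_expR; lra.
Qed.

(** Markov's inequality for [exp (|V|^2 / 12)]: the threshold is 12 times [5 (d + t)], so the [5 d]
    cancels and [exp (- 5 t)] remains. *)
Lemma subgaussian_norm_sq_tail (I : finType) (P : I -> R) d (V : I -> 'cV[R]_d) t :
  (forall i, 0 <= P i) ->
  (forall u, \sum_i P i * expR (dotv u (V i)) <= expR (2 * dotv u u)) ->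
  0 <= t ->
  \sum_(i | 60 * (d%:R + t) < dotv (V i) (V i)) P i <= expR (- t).
Proof.
move=> P0 mgf t0.
have := subgaussian_expR_norm_sq_le P0 mgf => hE.
apply: (@le_trans _ _ (expR (- (5 * d%:R) - 5 * t) *
    \sum_i P i * expR (dotv (V i) (V i) / 12))).
  rewrite mulr_sumr [leRHS](bigID (fun i => 60 * (d%:R + t) < dotv (V i) (V i))) /=.
  apply: ler_wpDr; first by rewrite sumr_ge0// => i _; rewrite !mulr_ge0 ?expR_ge0.
  apply: ler_sum => i hi; rewrite mulrCA ler_peMr// -expRD -[leLHS]expR0 ler_expR; lra.
apply: le_trans (ler_wpM2l (expR_ge0 _) hE) _.
by rewrite -expRD ler_expR; lra.
Qed.

End FiniteProbability.

(** * Privacy of randomized response *)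

Section RandomizedResponse.
Context {R : realType}.
Variables (n m : nat).
Implicit Types (y f : labels n m) (rho eps : R).

Lemma rr_rhoE eps : 2 * rr_rho eps m - 1 =
  (expR (eps / m%:R) - 1) / (expR (eps / m%:R) + 1).
Proof.
have := expR1D_gt0 (eps / m%:R); rewrite /rr_rho sigmoidE => h.
by field; rewrite gt_eqF//= addrC.
Qed.

Lemma flip_weight_user_le eps f f' (i : 'I_n) : 0 < eps -> (0 < m)%N ->
  (forall k, k.1 != i -> f k = f' k) ->
  flip_weight (rr_rho eps m) f <= expR eps * flip_weight (rr_rho eps m) f'.
Proof.
move=> eps0 m0 ff'.
(* The privacy budget is spread over the [m] labels of user [i], to be compared factor by factor. *)
have -> : expR eps = \prod_(k : idx n m) (if k.1 == i then expR (eps / m%:R) else 1).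
  rewrite -(pair_bigA _ (fun i' (j : 'I_m) =>
    if i' == i then expR (eps / m%:R) else 1)) /= (bigD1 i)//= eqxx.
  rewrite [X in _ * X]big1 ?mulr1; last by move=> i' /negPf ->; rewrite big1.
  rewrite prodr_const card_ord -expRM_natr divfK// pnatr_eq0 -lt0n//.
rewrite -big_split; apply: ler_prod => k _ /=.
have e1 : 1 < expR (eps / m%:R) by rewrite expR_gt1 divr_gt0// ltr0n.
have rho0 := sigmoid_gt0 (eps / m%:R); have rho1 := onem_sigmoid_gt0 (eps / m%:R).
rewrite -/(rr_rho _ _) in rho0 rho1.
have E : rr_rho eps m = expR (eps / m%:R) * (1 - rr_rho eps m).
  by rewrite /rr_rho onem_sigmoid sigmoidE.
have [ki|ki] := eqVneq k.1 i; last first.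
  by rewrite mul1r ff'// lexx andbT; case: ifP => _; apply: ltW.
by case: (f k); case: (f' k); rewrite ltW//=; nra.
Qed.

Lemma rr_user_label_DP d eps (M : labels n m -> 'cV[R]_d) :
  0 < eps -> (0 < m)%N -> user_label_DP eps (rr_rho eps m) M.
Proof.
move=> eps0 m0 y y' [i yy'] O; rewrite /mech_prob mulr_sumr.
(* This involution couples the two runs: flips [h f] on [y] and [f] on [y'] release the same labels,
   and [h f] differs from [f] only at user [i]. The estimator [M] is mere post-processing. *)
pose h f : labels n m := [ffun k => f k (+) (y k (+) y' k)].
have hK : involutive h.
  by move=> f; apply/ffunP => k; rewrite !ffunE -addbA addbb addbF.
rewrite (reindex_inj (inv_inj hK)) /=.
have E f : rr_apply y (h f) = rr_apply y' f.
  by apply/ffunP => k; rewrite !ffunE; case: (y k) (y' k) (f k) => [] [] [].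
under eq_bigl do rewrite E.
apply: ler_sum => f _; apply: (@flip_weight_user_le _ _ _ i) => // k ki.
by rewrite ffunE yy'// addbb addbF.
Qed.

End RandomizedResponse.

(** * Law and exponential moments of the randomized labels *)

Section RandomizedResponseLaw.
Context {R : realType}.
Variables (d n m : nat) (x : idx n m -> 'cV[R]_d) (thstar : 'cV[R]_d) (rho : R).
Hypotheses (rho0 : 0 <= rho) (rho1 : rho <= 1).

Definition rr_weight (yf : labels n m * labels n m) : R :=
  label_weight x thstar yf.1 * flip_weight rho yf.2.

(* The law of a randomized label: [P(yt_k = 1) = rho p_k + (1 - rho) (1 - p_k)]. *)
Definition rr_mean (k : idx n m) : R :=
  1 - rho + (2 * rho - 1) * sigmoid (dotv (x k) thstar).

Definition rr_noise (yt : labels n m) (k : idx n m) : R :=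
  (nat_of_bool (yt k))%:R - rr_mean k.

Lemma rr_weight_ge0 yf : 0 <= rr_weight yf.
Proof.
apply: mulr_ge0; apply: prodr_ge0 => k _; case: ifP => _; rewrite ?subr_ge0//.
- by rewrite ltW ?sigmoid_gt0.
- by rewrite -subr_ge0 ltW ?onem_sigmoid_gt0.
Qed.

Lemma rr_mean_itv k : 0 <= rr_mean k <= 1.
Proof.
rewrite /rr_mean; set p := sigmoid _.
have p0 : 0 <= p by rewrite ltW ?sigmoid_gt0.
have p1 : 0 <= 1 - p by rewrite ltW ?onem_sigmoid_gt0.
have r1 : 0 <= 1 - rho by rewrite subr_ge0.
have := mulr_ge0 rho0 p0; have := mulr_ge0 rho0 p1.
by have := mulr_ge0 r1 p0; have := mulr_ge0 r1 p1; lra.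
Qed.

(** Independence: summing out the flips and then the labels factorizes the expectation, and each
    factor is that of a Bernoulli variable of mean [rr_mean k]. *)
Lemma rr_expectation_prod (h : idx n m -> bool -> R) :
  \sum_yf rr_weight yf * \prod_k h k (rr_apply yf.1 yf.2 k) =
  \prod_k (rr_mean k * h k true + (1 - rr_mean k) * h k false).
Proof.
pose a k (b : bool) : R := let p := sigmoid (dotv (x k) thstar) in if b then p else 1 - p.
pose w (b : bool) : R := if b then 1 - rho else rho.
transitivity (\sum_(y : labels n m) \sum_(f : labels n m)
    \prod_k (a k (y k) * w (f k) * h k (y k (+) f k))).
  rewrite pair_bigA; apply: eq_bigr => -[y f] _ /=.
  rewrite /rr_weight /label_weight /flip_weight /= -!big_split; apply: eq_bigr => k _ /=.
  by rewrite ffunE /a /w; case: (y k) (f k) => [] [].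
have E (y : labels n m) : \sum_(f : labels n m)
      \prod_k (a k (y k) * w (f k) * h k (y k (+) f k)) =
    \prod_k (a k (y k) * w true * h k (y k (+) true) +
             a k (y k) * w false * h k (y k (+) false)).
  exact: (sum_prod_bool (fun k b => a k (y k) * w b * h k (y k (+) b))).
rewrite (eq_bigr _ (fun y _ => E y)).
rewrite (sum_prod_bool (fun k b => a k b * w true * h k (b (+) true) +
                                  a k b * w false * h k (b (+) false))).
by apply: eq_bigr => k _; rewrite /a /w /rr_mean /=; ring.
Qed.

Lemma rr_weight_sum1 : \sum_yf rr_weight yf = 1.
Proof.
have := rr_expectation_prod (fun _ _ => 1).
rewrite [RHS]big1 => [<-|k _]; last by ring.
by apply: eq_bigr => yf _; rewrite big1_eq mulr1.
Qed.

Lemma rr_noise_mgf_le (w : idx n m -> 'cV[R]_d) (u : 'cV[R]_d) :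
  \sum_yf rr_weight yf *
     expR (dotv u (\sum_k rr_noise (rr_apply yf.1 yf.2) k *: w k)) <=
  expR (2 * \sum_k dotv u (w k) ^+ 2).
Proof.
pose h k (b : bool) := expR (dotv u (w k) * ((nat_of_bool b)%:R - rr_mean k)).
have E yf : expR (dotv u (\sum_k rr_noise (rr_apply yf.1 yf.2) k *: w k)) =
    \prod_k h k (rr_apply yf.1 yf.2 k).
  rewrite dotvC dotv_suml expR_sum; apply: eq_bigr => k _.
  by rewrite dotvZl dotvC mulrC.
under eq_bigr do rewrite E.
rewrite rr_expectation_prod mulr_sumr expR_sum; apply: ler_prod => k _.
have /andP[q0 q1] := rr_mean_itv k.
rewrite addr_ge0 ?mulr_ge0 ?expR_ge0 ?subr_ge0//=.
exact: bernoulli_mgf_le.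
Qed.

End RandomizedResponseLaw.

(** * Consequences of minimality of the estimator *)

Section BasicInequality.
Context {R : realType}.
Variables (d n m : nat).

Lemma rr_lossE eps (x : idx n m -> 'cV[R]_d) (yt : labels n m) th :
  rr_loss eps x yt th = \sum_k ((2 * rr_rho eps m - 1) * softplus (dotv (x k) th)
     - ((nat_of_bool (yt k))%:R - (1 - rr_rho eps m)) * dotv (x k) th).
Proof.
rewrite /rr_loss -sumrN; apply: eq_bigr => k _.
by case: (yt k); rewrite ?ln_phat1 ?ln_phat0 /=; ring.
Qed.

Lemma rr_gap_gt0 eps : 0 < eps -> (0 < m)%N -> 0 < 2 * rr_rho eps m - 1 :> R.
Proof.
move=> eps0 m0; rewrite rr_rhoE divr_gt0//.
by rewrite subr_gt0 expR_gt1 divr_gt0 ?ltr0n.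
Qed.

Lemma dotv_le_of_norm2 (u : 'cV[R]_d) (r : R) : norm2 u <= r -> dotv u u <= r ^+ 2.
Proof.
move=> ur; have r0 : 0 <= r by rewrite (le_trans _ ur)// sqrtr_ge0.
by rewrite -(sqr_sqrtr (dotv_ge0 u)) lerXn2r// nnegrE sqrtr_ge0.
Qed.

Lemma dotv_sub_le (u v th : 'cV[R]_d) (L B : R) :
  norm2 u <= L -> norm2 v <= L -> norm2 th <= B ->
  `|dotv (u - v) th| <= 2 * L * B.
Proof.
move=> uL vL tB.
have L0 : 0 <= L by rewrite (le_trans _ uL)// sqrtr_ge0.
have B0 : 0 <= B by rewrite (le_trans _ tB)// sqrtr_ge0.
have LB0 : 0 <= 2 * L * B by rewrite !mulr_ge0.
rewrite -ler_sqr ?nnegrE// real_normK ?num_real//.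
apply: le_trans (dotv_cauchy_schwarz _ _) _.
have := dotv_le_of_norm2 uL; have := dotv_le_of_norm2 vL.
(* Yields [|u - v|^2 <= 2 |u|^2 + 2 |v|^2]. *)
have uv := dotv_ge0 (u + v); rewrite dotvDl !dotvDr (dotvC v u) in uv.
move=> hv hu.
have -> : (2 * L * B) ^+ 2 = (4 * L ^+ 2) * B ^+ 2 by ring.
apply: ler_pM; [exact: dotv_ge0|exact: dotv_ge0| |exact: dotv_le_of_norm2].
by rewrite dotvBl !dotvBr (dotvC v u); lra.
Qed.

(** Strong convexity at [thstar] is applied to each summand; its slope [(2 * rho - 1) * sigmoid]
    merges with the label term into exactly [rr_noise]. *)
Lemma rr_basic_inequality eps (x : idx n m -> 'cV[R]_d) yt (th thstar : 'cV[R]_d) K :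
  0 < eps -> (0 < m)%N ->
  (forall k, `|dotv (x k) th| <= K) -> (forall k, `|dotv (x k) thstar| <= K) ->
  rr_loss eps x yt th <= rr_loss eps x yt thstar ->
  (2 * rr_rho eps m - 1) * (1 / (2 + expR (- K) + expR K)) / 2 *
     \sum_k dotv (x k) (th - thstar) ^+ 2 <=
  dotv (\sum_k rr_noise x thstar (rr_rho eps m) yt k *: x k) (th - thstar).
Proof.
move=> eps0 m0 thK tsK; rewrite !rr_lossE -subr_ge0 -sumrB => hmin.
rewrite dotv_suml mulr_sumr -subr_ge0 -sumrB.
apply: le_trans hmin _; apply: ler_sum => k _.
have c0 : 0 <= 2 * rr_rho eps m - 1.
  exact/ltW/rr_gap_gt0.
have := ler_wpM2l c0 (softplus_strongly_convex (tsK k) (thK k)).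
rewrite dotvZl dotvBr /rr_noise /rr_mean; lra.
Qed.

End BasicInequality.

(** * Gram matrix and whitened noise *)

Section Gram.
Context {R : realType}.
Variables (I : finType) (d : nat) (x : I -> 'cV[R]_d).

Definition gram : 'M[R]_d := \sum_k x k *m (x k)^T.

Lemma gram_sym : gram^T = gram.
Proof.
rewrite /gram raddf_sum; apply: eq_bigr => k _.
by rewrite /= trmx_mul trmxK.
Qed.

Lemma gram_mulmx (v : 'cV[R]_d) : gram *m v = \sum_k dotv (x k) v *: x k.
Proof.
rewrite /gram mulmx_suml; apply: eq_bigr => k _.
by rewrite -mulmxA [X in _ *m X]mx11_scalar mul_mx_scalar dotvE.
Qed.

Lemma dotv_gram (u : 'cV[R]_d) : dotv u (gram *m u) = \sum_k dotv (x k) u ^+ 2.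
Proof.
rewrite gram_mulmx dotvC dotv_suml; apply: eq_bigr => k _.
by rewrite dotvZl expr2.
Qed.

Variable T : 'M[R]_d.
Hypothesis TG : T *m gram *m T^T = 1%:M.

(** The sum is the Gram form at [T^T u]. It makes the moment bound of the whitened noise
    [exp (2 |u|^2)], free of the features. *)
Lemma sum_sqr_whitened (u : 'cV[R]_d) : \sum_k dotv u (T *m x k) ^+ 2 = dotv u u.
Proof.
transitivity (\sum_k dotv (x k) (T^T *m u) ^+ 2).
  by apply: eq_bigr => k _; rewrite dotv_mulmx dotvC.
by rewrite -dotv_gram -dotv_mulmx !mulmxA TG mul1mx.
Qed.

(* Cauchy-Schwarz between [T S] and [T G D], whose squared norm is [<D, G D>]. *)
Lemma whitened_quadratic_bound (S D : 'cV[R]_d) (c : R) : 0 <= c ->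
  c * \sum_k dotv (x k) D ^+ 2 <= dotv S D ->
  c ^+ 2 * \sum_k dotv (x k) D ^+ 2 <= dotv (T *m S) (T *m S).
Proof.
move=> c0; rewrite -dotv_gram; set Q := dotv D _ => hQ.
(* [T] is square, so one-sided inverses are two-sided and [T^T T] inverts the Gram matrix. *)
have GTT : gram *m T^T *m T = 1%:M by apply: mulmx1C; rewrite mulmxA.
have TTG : T^T *m T *m gram = 1%:M by apply: mulmx1C; rewrite mulmxA.
have Q0 : 0 <= Q by rewrite /Q dotv_gram sumr_ge0// => k _; rewrite sqr_ge0.
have SD : dotv S D = dotv (T *m S) (T *m (gram *m D)).
  by rewrite [RHS]dotv_mulmx [RHS]dotv_mulmx gram_sym !mulmxA GTT mul1mx.
have GD : dotv (T *m (gram *m D)) (T *m (gram *m D)) = Q.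
  by rewrite dotv_mulmx !mulmxA TTG mul1mx.
have := dotv_cauchy_schwarz (T *m S) (T *m (gram *m D)).
rewrite -SD GD => CS.
have [->|Qn0] := eqVneq Q 0; first by rewrite mulr0 dotv_ge0.
have Qp : 0 < Q by rewrite lt_neqAle eq_sym Qn0.
rewrite -(ler_pM2r Qp) (le_trans _ CS)//.
have -> : c ^+ 2 * Q * Q = (c * Q) ^+ 2 by ring.
by rewrite lerXn2r ?nnegrE ?mulr_ge0// (le_trans _ hQ)// mulr_ge0.
Qed.

End Gram.

(** * Eigenvalue bound, high-probability event and conclusion *)

Section Assembly.
Context {R : realType}.
Variables (d n m : nat).

Lemma dotv_SigmaD (x : idx n m -> 'cV[R]_d) (v : 'cV[R]_d) :
  dotv v (SigmaD x *m v) = (n * m)%:R^-1 * \sum_k dotv (x k) v ^+ 2.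
Proof. by rewrite -dotv_gram -scalemxAl dotvZr. Qed.

Lemma SigmaD_lambda_min_le (x : idx n m -> 'cV[R]_d) (lam : R) :
  (0 < n)%N -> (0 < m)%N -> is_lambda_min (SigmaD x) lam ->
  forall v, lam * (n * m)%:R * dotv v v <= \sum_k dotv (x k) v ^+ 2.
Proof.
move=> n0 m0 hlam v.
have nm0 : 0 < (n * m)%:R :> R by rewrite ltr0n muln_gt0 n0.
have sym : (SigmaD x)^T = SigmaD x by rewrite linearZ /= -/(gram x) gram_sym.
have := rayleigh_lambda_min sym hlam v.
by rewrite dotv_SigmaD ler_pdivlMl// mulrCA mulrA.
Qed.

Lemma SigmaD_whitening (x : idx n m -> 'cV[R]_d) (lam : R) :
  (0 < n)%N -> (0 < m)%N -> is_lambda_min (SigmaD x) lam -> 0 < lam ->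
  exists T : 'M[R]_d, T *m gram x *m T^T = 1%:M.
Proof.
move=> n0 m0 hlam lam0; apply: psd_partial_whitening (leqnn d).
  exact: gram_sym.
move=> v v0; rewrite dotv_gram.
apply: lt_le_trans (SigmaD_lambda_min_le n0 m0 hlam v).
by rewrite !mulr_gt0// ?ltr0n ?muln_gt0 ?n0// dotv_gt0.
Qed.

(** [E] can fail only on the tail event of the whitened noise, and the total weight is 1. *)
Lemma joint_prob_ge (x : idx n m -> 'cV[R]_d) (thstar : 'cV[R]_d) (rho t : R)
    (T : 'M[R]_d) (E : labels n m -> labels n m -> Prop) :
  0 <= rho -> rho <= 1 -> 0 <= t -> T *m gram x *m T^T = 1%:M ->
  (forall y yt, let V := T *m \sum_k rr_noise x thstar rho yt k *: x k in
     dotv V V <= 60 * (d%:R + t) -> E y yt) ->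
  1 - expR (- t) <= joint_prob x thstar rho E.
Proof.
move=> rho0 rho1 t0 TG good.
pose V yf := T *m \sum_k rr_noise x thstar rho (rr_apply yf.1 yf.2) k *: x k.
have P0 := rr_weight_ge0 x thstar rho0 rho1.
have mgf u : \sum_yf rr_weight x thstar rho yf * expR (dotv u (V yf)) <=
    expR (2 * dotv u u).
  have := rr_noise_mgf_le x thstar rho0 rho1 (fun k => T *m x k) u.
  rewrite (sum_sqr_whitened TG) => /(le_trans _); apply.
  rewrite le_eqVlt; apply/orP; left; apply/eqP; apply: eq_bigr => yf _.
  rewrite /V mulmx_sumr; congr (_ * expR (dotv _ _)); apply: eq_bigr => k _.
  by rewrite scalemxAr.
have tail := subgaussian_norm_sq_tail P0 mgf t0.
rewrite lerBlDr -(rr_weight_sum1 x thstar rho).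
rewrite (bigID (fun yf => `[< E yf.1 (rr_apply yf.1 yf.2) >])) /= lerD2l.
apply: le_trans tail.
rewrite big_mkcond [leRHS]big_mkcond; apply: ler_sum => yf _.
case: ifP => [/asboolPn nE|_]; last by case: ifP.
case: ifPn => //; rewrite -leNgt => hV.
by case: nE; apply: good.
Qed.

End Assembly.

Theorem theorem1 :
  forall R : realType, exists C : R, 0 < C /\
  forall (S A : Type) (d n m : nat) (eps alpha B L : R)
    (phi : S -> A -> 'cV[R]_d) (s : idx n m -> S) (a0 a1 : idx n m -> A)
    (thstar : 'cV[R]_d) (thetahat : labels n m -> 'cV[R]_d),
  0 < eps -> (0 < n)%N -> (0 < m)%N -> 0 < alpha -> alpha < 1 ->
  ThetaB B thstar ->
  (forall (s0 : S) (a : A), norm2 (phi s0 a) <= L) ->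
  (* thetahat(yt) is a minimizer of the RR loss over Theta_B, for every
     randomized label vector yt *)
  (forall yt : labels n m,
     ThetaB B (thetahat yt) /\
     (forall th : 'cV[R]_d, ThetaB B th ->
        rr_loss eps (diff_feat phi s a0 a1) yt (thetahat yt)
        <= rr_loss eps (diff_feat phi s a0 a1) yt th)) ->
  user_label_DP eps (rr_rho eps m) thetahat /\
  (forall lam : R, is_lambda_min (SigmaD (diff_feat phi s a0 a1)) lam -> 0 < lam ->
     1 - alpha <=
     joint_prob (diff_feat phi s a0 a1) thstar (rr_rho eps m)
       (fun _ yt => norm2 (thetahat yt - thstar) <=
          C * (1 / (gammaLB L B * Num.sqrt lam))
            * ((expR (eps / m%:R) + 1) / (expR (eps / m%:R) - 1))
            * Num.sqrt ((d%:R + ln (1 / alpha)) / (n * m)%:R))).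

Proof.
(* With [c gamma / 2] squared, the constant 16 gives [16^2 / 4 = 64], which dominates the 60 of the
   tail bound. *)
move=> R; exists 16; split => // S A d n m eps alpha B L phi s a0 a1 thstar thetahat.
move=> eps0 n0 m0 alpha0 alpha1 [ts0 tsB] phiL hmin; split.
  exact: rr_user_label_DP.
move=> lam hlam lam0; set x := diff_feat phi s a0 a1.
have [T TG] := SigmaD_whitening n0 m0 hlam lam0.
have rho0 : 0 <= rr_rho eps m by rewrite ltW ?sigmoid_gt0.
have rho1 : rr_rho eps m <= 1 by rewrite -subr_ge0 ltW ?onem_sigmoid_gt0.
set t := ln (1 / alpha).
have t0 : 0 <= t by rewrite ln_ge0// div1r invf_ge1// ltW.
have -> : alpha = expR (- t) by rewrite /t div1r lnV ?posrE// opprK lnK.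
apply: (@joint_prob_ge _ _ _ _ _ _ _ _ T) => // y yt V hV.
have [[_ thB] /(_ thstar (conj ts0 tsB)) hle] := hmin yt.
set D := thetahat yt - thstar.
have c0 := rr_gap_gt0 eps0 m0 : 0 < 2 * rr_rho eps m - 1.
have -> : (expR (eps / m%:R) + 1) / (expR (eps / m%:R) - 1) = (2 * rr_rho eps m - 1)^-1.
  by rewrite rr_rhoE invf_div.
set c := 2 * rr_rho eps m - 1 in c0 *.
have g0 : 0 < gammaLB L B by rewrite divr_gt0// !addr_gt0 ?expR_gt0.
have bound th : norm2 th <= B -> forall k, `|dotv (x k) th| <= 2 * L * B.
  by move=> thB' k; apply: dotv_sub_le.
have := rr_basic_inequality eps0 m0 (bound _ thB) (bound _ tsB) hle.
rewrite -/c -/D -/(gammaLB L B) => basic.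
have cg0 : 0 < c * gammaLB L B / 2 by rewrite !mulr_gt0.
have := whitened_quadratic_bound TG (ltW cg0) basic; rewrite -/V => quad.
have nm0 : 0 < (n * m)%:R :> R by rewrite ltr0n muln_gt0 n0.
have lam_le := SigmaD_lambda_min_le n0 m0 hlam D.
have dt0 : 0 <= d%:R + t by rewrite addr_ge0.
set r := (X in _ <= X).
have r0 : 0 <= r.
  by rewrite !mulr_ge0 ?sqrtr_ge0 ?invr_ge0 ?mulr_ge0 ?sqrtr_ge0// ltW.
have rE : r ^+ 2 * ((c * gammaLB L B / 2) ^+ 2 * (lam * (n * m)%:R)) = 64 * (d%:R + t).
  rewrite /r !exprMn !exprVn !exprMn.
  rewrite (sqr_sqrtr (ltW lam0)) (sqr_sqrtr (divr_ge0 dt0 (ltW nm0))).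
  by field; do ?[apply/andP; split]; rewrite gt_eqF ?ltr0n// ?addr_gt0 ?expR_gt0.
rewrite /norm2 -(ger0_norm r0) -sqrtr_sqr ler_wsqrtr//.
have pos : 0 < (c * gammaLB L B / 2) ^+ 2 * (lam * (n * m)%:R).
  by rewrite mulr_gt0 ?exprn_gt0// mulr_gt0.
(* The chain is [(c gamma / 2)^2 n m lam |D|^2 <= (c gamma / 2)^2 Q <= |V|^2 <= 60 (d + t)]. *)
rewrite -(ler_pM2r pos) rE [leLHS]mulrC -[leLHS]mulrA.
apply: le_trans (ler_wpM2l (ltW (exprn_gt0 2 cg0)) lam_le) _.
by rewrite (le_trans quad)// (le_trans hV)// ler_wpM2r// ler_nat.
Qed.
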